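(* Let $r>0$ and $h<0$. There exists $\boldsymbol{\phi}\in C_c^\infty(\mathbb{R}^2;\mathbb{R}^3)$ such that $$E_{r,h}\Big[\frac{\mathbf{e}_3+t\boldsymbol{\phi}}{|\mathbf{e}_3+t\boldsymbol{\phi}|}\Big]<E_{r,h}[\mathbf{e}_3]=0$$ for all sufficiently small $t\in\mathbb{R}$ with $t\neq0$.
   Context: Maps $\mathbf{n}=(n_1,n_2,n_3):\mathbb{R}^2\to\mathbb{S}^2\subset\mathbb{R}^3$; $\mathbf{e}_3=(0,0,1)$. $D[\mathbf{n}]=\frac12\int|\nabla\mathbf{n}|^2dx$, $H[\mathbf{n}]=\int(\mathbf{n}-\mathbf{e}_3)\cdot(\nabla\times\mathbf{n})dx$ with $\nabla\times\mathbf{n}=(\partial_2n_3,-\partial_1n_3,\partial_1n_2-\partial_2n_1)$, $V[\mathbf{n}]=\frac18\int|\mathbf{n}-\mathbf{e}_3|^4dx$, $Z[\mathbf{n}]=\int(1-n_3)dx$ (integrals over $\mathbb{R}^2$), and $E_{r,h}=D+rH+V+hZ$. *)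

(* Defs.v *)
From HB Require Import structures.
From mathcomp Require Import all_boot all_order all_algebra.
From mathcomp Require Import all_classical all_reals all_analysis.
Set Implicit Arguments. Unset Strict Implicit. Unset Printing Implicit Defensive.
Import Order.TTheory GRing.Theory Num.Theory.
Import numFieldNormedType.Exports.
Local Open Scope classical_set_scope.
Local Open Scope ring_scope.

Section Defs.
Variable R : realType.

Definition partial1 (f : R * R -> R) : R * R -> R :=
  fun p => derive1 (fun s => f (s, p.2)) p.1.
Definition partial2 (f : R * R -> R) : R * R -> R :=
  fun p => derive1 (fun s => f (p.1, s)) p.2.

Fixpoint Ck (k : nat) (f : R * R -> R) : Prop :=
  match k with
  | 0 => continuous f
  | k'.+1 => [/\ continuous f,
                (forall p : R * R, derivable (fun s => f (s, p.2)) p.1 1),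
                (forall p : R * R, derivable (fun s => f (p.1, s)) p.2 1),
                Ck k' (partial1 f) & Ck k' (partial2 f)]
  end.

Definition smooth (f : R * R -> R) : Prop := forall k, Ck k f.

Definition compact_support (f : R * R -> R) : Prop :=
  compact (closure [set p | f p != 0]).

Definition Cc_infty (f : R * R -> R) : Prop := smooth f /\ compact_support f.

Record field3 := Field3 { c1 : R * R -> R; c2 : R * R -> R; c3 : R * R -> R }.

Definition e3map : field3 := Field3 (fun _ => 0) (fun _ => 0) (fun _ => 1).

Definition normalize_pert (phi : field3) (t : R) : field3 :=
  let u1 := fun p => t * c1 phi p in
  let u2 := fun p => t * c2 phi p in
  let u3 := fun p => 1 + t * c3 phi p in
  let nrm := fun p => Num.sqrt (u1 p ^+ 2 + u2 p ^+ 2 + u3 p ^+ 2) in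
  Field3 (fun p => u1 p / nrm p) (fun p => u2 p / nrm p) (fun p => u3 p / nrm p).

Definition leb2 := ((@lebesgue_measure R) \x (@lebesgue_measure R))%E.

Definition integral2 (f : R * R -> R) : \bar R :=
  (\int[leb2]_p (f p)%:E)%E.

Definition dirichlet_density (n : field3) (p : R * R) : R :=
  (partial1 (c1 n) p ^+ 2 + partial2 (c1 n) p ^+ 2
 + partial1 (c2 n) p ^+ 2 + partial2 (c2 n) p ^+ 2
 + partial1 (c3 n) p ^+ 2 + partial2 (c3 n) p ^+ 2) / 2.

(* (n - e3) . curl n, curl n = (d2 n3, - d1 n3, d1 n2 - d2 n1) *)
Definition helicity_density (n : field3) (p : R * R) : R :=
  c1 n p * partial2 (c3 n) p
  + c2 n p * (- partial1 (c3 n) p)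
  + (c3 n p - 1) * (partial1 (c2 n) p - partial2 (c1 n) p).

Definition potential_density (n : field3) (p : R * R) : R :=
  (c1 n p ^+ 2 + c2 n p ^+ 2 + (c3 n p - 1) ^+ 2) ^+ 2 / 8.

Definition zeeman_density (n : field3) (p : R * R) : R := 1 - c3 n p.

Definition Denergy n := integral2 (dirichlet_density n).
Definition Henergy n := integral2 (helicity_density n).
Definition Venergy n := integral2 (potential_density n).
Definition Zenergy n := integral2 (zeeman_density n).

Definition Energy (r h : R) (n : field3) : \bar R :=
  (Denergy n + r%:E * Henergy n + Venergy n + h%:E * Zenergy n)%E.

End Defs.

(* Main.v *)
(** Tilt [e3] in a single direction: for [phi = (f, 0, 0)] the perturbed field is
    [(s v, 0, v)] with [s = t f] and [v = 1 / sqrt (1 + s^2)].  At order [t^2]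
    only the Dirichlet and Zeeman terms survive; the helicity is [O(|t|^3)] and
    the potential [O(t^4)].  With [f] a bump on the square [[0, L]^2], the
    Dirichlet energy is bounded independently of [L] (scale invariance in the
    plane), whereas [h Z] is at most [- const |h| t^2 L^2], so a large [L]
    makes the second variation negative. *)
Require Import Defs.
From HB Require Import structures.
From mathcomp Require Import all_boot all_order all_algebra.
From mathcomp Require Import all_classical all_reals all_analysis.
From mathcomp Require Import ring lra.
Import Order.TTheory GRing.Theory Num.Theory.
Import numFieldNormedType.Exports.
Local Open Scope classical_set_scope.
Local Open Scope ring_scope.

(** * Flat functions and smoothness of tensor products *)

Section flat.
Context {R : realType}.
Implicit Types (n k : nat) (x : R) (a b : R -> R).

(** The powers of 1/x make the family closed under differentiation up to linear combinations, so
    smoothness of every member follows by a single induction. *)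
Definition flat n x : R := if 0 < x then x^-1 ^+ n * expR (- x^-1) else 0.

Lemma flat_ge0 n x : 0 <= flat n x.
Proof.
rewrite /flat; case: ifP => // x0.
by rewrite mulr_ge0 ?expR_ge0// exprn_ge0// invr_ge0 ltW.
Qed.

Lemma flat_le0 n x : x <= 0 -> flat n x = 0.
Proof. by rewrite /flat ltNge => ->. Qed.

(** With y = 1/x this is y^n <= n! e^y, read off from one term of the exponential series. *)
Lemma flat_le n x : flat n x <= n`!%:R.
Proof.
rewrite /flat; case: ifP => // x0.
rewrite expRN ler_pdivrMr ?expR_gt0//.
case: n => [|n].
  by rewrite expr0 fact0 mul1r -expR0 ler_expR invr_ge0 ltW.
have x0' : 0 <= x^-1 by rewrite invr_ge0 ltW.
have := expR_ge1Dxn n x0'.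
have f0 : (0 : R) < n.+1`!%:R by rewrite ltr0n fact_gt0.
rewrite -ler_pdivrMl// mulrC => h; apply: le_trans h.
by rewrite lerDr.
Qed.

(* [flat n.+1] is the difference quotient of [flat n] at 0. *)
Lemma flatS n x : flat n x = flat n.+1 x * x.
Proof.
rewrite /flat; case: ifP => x0; last by rewrite mul0r.
by rewrite exprS [RHS]mulrC !mulrA divff ?mul1r// gt_eqF.
Qed.

Lemma is_derive_flat n x :
  is_derive x 1 (flat n) (flat n.+2 x - n%:R * flat n.+1 x).
Proof.
have [x0|x0|->] := ltgtP x 0.
- rewrite !flat_le0 ?(ltW x0)// mulr0 subr0.
  apply: (@near_eq_is_derive _ _ _ (cst 0)).
  near=> y; rewrite flat_le0//= ltW//; near: y; exact: lt_nbhsl.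
- have dV : is_derive x 1 (fun y : R => y^-1) (- x ^- 2 *: 1).
    by apply: is_deriveV; rewrite ?gt_eqF.
  have dE : is_derive x 1 (fun y : R => expR (- y^-1)) (expR (- x^-1) * - (- x ^- 2 *: 1)).
    by apply: (@is_derive1_comp _ expR (fun y => - y^-1)).
  apply: near_eq_is_derive (is_derive_eq (is_deriveM (is_deriveX n dV) dE) _).
    near=> y; rewrite /flat ifT ?fctE//; near: y; exact: lt_nbhsr.
  rewrite /flat x0 /GRing.scale/= !mulr1 !fctE /=.
  (* The power rule lowers the exponent, so exponent 0 is treated apart. *)
  case: n => [|n] /=; first by rewrite !expr0 !mul0r !mulr0 addr0 subr0 mul1r opprK exprVn mulrC.
  rewrite -exprVn !exprS; ring.
- rewrite !flat_le0// mulr0 subr0.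
  (* At 0 the slope function is [flat n.+1]. It is continuous there because it equals z times
     [flat n.+2], which is bounded by (n+2)!. *)
  apply/is_derive1_caratheodory; exists (flat n.+1); split.
  + by move=> z; rewrite (flat_le0 _ 0)// !subr0 flatS.
  + suff: flat n.+1 z @[z --> (0 : R)] --> flat n.+1 0 by [].
    rewrite flat_le0//; apply/cvgrPdist_le => e e0; near=> z.
    rewrite sub0r normrN flatS normrM ger0_norm ?flat_ge0//.
    rewrite (@le_trans _ _ (n.+2`!%:R * `|z|))// ?ler_wpM2r// ?flat_le//.
    rewrite -ler_pdivlMl ?ltr0n ?fact_gt0//.
    near: z; apply: (@nbhs0_le _ R); rewrite mulr_gt0// invr_gt0 ltr0n fact_gt0//.
  + by rewrite flat_le0.
Unshelve. all: by end_near. Qed.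

(** Carrying the derivative as a witness lets each closure lemma name it explicitly instead of
    computing with [derive1]. *)
Fixpoint Ck1 k a : Prop :=
  match k with
  | 0 => continuous a
  | k'.+1 => exists2 b, (forall x, is_derive x 1 a (b x)) & Ck1 k' b
  end.

Lemma Ck1_continuous k a : Ck1 k a -> continuous a.
Proof.
case: k => // k [b ab _] x.
by apply/differentiable_continuous/derivable1_diffP; case: (ab x).
Qed.

Lemma Ck1S k a : Ck1 k.+1 a -> Ck1 k a.
Proof.
elim: k a => [|k IH] a; first exact: Ck1_continuous.
by move=> [b ab bk]; exists b => //; exact: IH.
Qed.

Lemma Ck1D k a b : Ck1 k a -> Ck1 k b -> Ck1 k (a \+ b).
Proof.
elim: k a b => [|k IH] a b /=; first by move=> ca cb x; apply: continuousD; [exact: ca|exact: cb].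
move=> [a' da ka] [b' db kb]; exists (a' \+ b'); last exact: IH.
by move=> x; apply: is_deriveD.
Qed.

Lemma Ck1M k a b : Ck1 k a -> Ck1 k b -> Ck1 k (a \* b).
Proof.
elim: k a b => [|k IH] a b; first by move=> ca cb x; apply: continuousM; [exact: ca|exact: cb].
move=> ha hb; have [a' da ka] := ha; have [b' db kb] := hb.
exists ((a \* b') \+ (b \* a')); last by apply: Ck1D; apply: IH => //; exact: Ck1S.
by move=> x; apply: is_deriveM.
Qed.

Lemma Ck1_cst k (c : R) : Ck1 k (cst c).
Proof.
elim: k c => [|k IH] c /=; first by move=> x; exact: cst_continuous.
by exists (cst 0) => // x; exact: is_derive_cst.
Qed.

Lemma is_derive_affine (c d x : R) : is_derive x 1 (fun y => c * y + d) c.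
Proof.
have := is_deriveD (is_deriveZ c (is_derive_id x 1)) (is_derive_cst d x 1).
by move=> H; apply: (is_derive_eq H); rewrite addr0 /GRing.scale/= mulr1.
Qed.

(** Serves both the reflection x -> 1 - x in [hat] and the dilation x -> x / L in [cutoff]. *)
Lemma Ck1_affine k a (c d : R) : Ck1 k a -> Ck1 k (fun x => a (c * x + d)).
Proof.
elim: k a => [|k IH] a.
  move=> /= ca x; apply: (@continuous_comp _ _ _ (fun x => c * x + d) a); last exact: ca.
  apply/differentiable_continuous/derivable1_diffP.
  by case: (is_derive_affine c d x).
move=> [b ab bk]; exists ((fun x => b (c * x + d)) \* cst c); last first.
  by apply: Ck1M; [exact: IH|exact: Ck1_cst].
move=> x; apply: (@is_derive1_comp _ a (fun y => c * y + d)).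
exact: is_derive_affine.
Qed.

Lemma Ck1_flat k n : Ck1 k (flat n).
Proof.
elim: k n => [|k IH] n.
  by move=> x; apply/differentiable_continuous/derivable1_diffP; case: (is_derive_flat n x).
exists (flat n.+2 \+ (cst (- n%:R) \* flat n.+1)).
  by move=> x; rewrite /= mulNr; exact: is_derive_flat.
by apply: Ck1D => //; apply: Ck1M => //; exact: Ck1_cst.
Qed.

Lemma continuous_tensor a b : continuous a -> continuous b ->
  continuous (fun p : R * R => a p.1 * b p.2).
Proof.
move=> ca cb p; apply: (@continuousM _ _ (fun p : R * R => a p.1) (fun p => b p.2)).
  by apply: (@continuous_comp _ _ _ fst a); [exact: cvg_fst|exact: ca].
by apply: (@continuous_comp _ _ _ snd b); [exact: cvg_snd|exact: cb].
Qed.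

Lemma is_derive_mull a b x (c : R) :
  is_derive x 1 a (b x) -> is_derive x 1 (fun y => c * a y) (c * b x).
Proof. exact: is_deriveZ. Qed.

Lemma is_derive_mulr a b x (c : R) :
  is_derive x 1 a (b x) -> is_derive x 1 (fun y => a y * c) (b x * c).
Proof.
rewrite mulrC (_ : (fun y => _) = (fun y => c * a y)); first exact: is_deriveZ.
by apply/funext => y; rewrite mulrC.
Qed.

Lemma derive1_is_derive {f : R -> R} {x d} : is_derive x 1 f d -> derive1 f x = d.
Proof. by rewrite derive1E => -[]. Qed.

(** Both partial derivatives of a tensor product are again tensor products, so the induction reduces
    to one-variable regularity. *)
Lemma Ck_tensor k a b : Ck1 k a -> Ck1 k b ->
  Ck k (fun p : R * R => a p.1 * b p.2).
Proof.
elim: k a b => [|k IH] a b ha hb; first exact: continuous_tensor.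
have [a' da ka] := ha; have [b' db kb] := hb.
have d1 (p : R * R) : is_derive p.1 1 (fun s => a s * b p.2) (a' p.1 * b p.2).
  exact: is_derive_mulr.
have d2 (p : R * R) : is_derive p.2 1 (fun s => a p.1 * b s) (a p.1 * b' p.2).
  exact: is_derive_mull.
split.
- by apply: continuous_tensor; apply: Ck1_continuous; eassumption.
- by move=> p; case: (d1 p).
- by move=> p; case: (d2 p).
- rewrite (_ : partial1 _ = fun p : R * R => a' p.1 * b p.2).
    by apply: IH => //; exact: Ck1S.
  by apply/funext => p; exact: derive1_is_derive.
- rewrite (_ : partial2 _ = fun p : R * R => a p.1 * b' p.2).
    by apply: IH => //; exact: Ck1S.
  by apply/funext => p; exact: derive1_is_derive.
Qed.

End flat.

(** * A one-dimensional bump supported in the unit interval *)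

Section hat.
Context {R : realType}.
Implicit Types x : R.

Definition hat x : R := flat 0 x * flat 0 (1 - x).

Definition dhat x : R := flat 2 x * flat 0 (1 - x) - flat 0 x * flat 2 (1 - x).

Lemma one_sub_affine x : 1 - x = -1 * x + 1.
Proof. by rewrite mulN1r addrC. Qed.

Lemma is_derive_hat x : is_derive x 1 hat (dhat x).
Proof.
have d0 (y : R) : is_derive y 1 (flat 0) (flat 2 y).
  by apply: is_derive_eq (is_derive_flat 0 y) _; rewrite mul0r subr0.
have d1 : is_derive x 1 (fun y => flat 0 (1 - y)) (flat 2 (1 - x) * -1).
  apply: (@is_derive1_comp _ (flat 0) (fun y : R => 1 - y)).
  rewrite (_ : (fun y : R => 1 - y) = (fun y => -1 * y + 1)).
    exact: is_derive_affine.
  by apply/funext => y; rewrite one_sub_affine.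
apply: is_derive_eq (is_deriveM (d0 x) d1) _.
by rewrite /dhat /GRing.scale/= mulrN1 mulrN addrC mulrC.
Qed.

Lemma Ck1_hat k : Ck1 k hat.
Proof.
apply: (@Ck1M _ k (flat 0) (fun x => flat 0 (1 - x))); first exact: Ck1_flat.
rewrite (_ : (fun x => _) = (fun x => flat 0 (-1 * x + 1))).
  exact/Ck1_affine/Ck1_flat.
by apply/funext => y; rewrite one_sub_affine.
Qed.

Lemma hat_ge0 x : 0 <= hat x.
Proof. by rewrite mulr_ge0 ?flat_ge0. Qed.

Lemma hat_le1 x : hat x <= 1.
Proof. by rewrite mulr_ile1 ?flat_ge0//; exact: (flat_le 0). Qed.

Lemma hat_dhat_out x : ~~ (0 <= x <= 1) -> hat x = 0 /\ dhat x = 0.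
Proof.
rewrite negb_and -!ltNge => /orP[x0|x1].
  by rewrite /hat /dhat !(flat_le0 _ x (ltW x0)) !mul0r subr0.
have h : 1 - x <= 0 by rewrite subr_le0 ltW.
by rewrite /hat /dhat !(flat_le0 _ _ h) !mulr0 subr0.
Qed.

(** The factorial bounds 0! and 2! put both products in [0, 2], hence their difference in
    [-2, 2]. *)
Lemma norm_dhat_le x : `|dhat x| <= 2.
Proof.
have b0 (y : R) : 0 <= flat 0 y <= 1 by rewrite flat_ge0 (flat_le 0).
have b2 (y : R) : 0 <= flat 2 y <= 2 by rewrite flat_ge0 (flat_le 2).
have := b0 x; have := b0 (1 - x); have := b2 x; have := b2 (1 - x).
rewrite /dhat ler_norml; nra.
Qed.

(** On the middle half both x and 1 - x are at least 1/4, so each factor is at least e^(-4). *)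
Lemma hat_ge x : 4^-1 <= x <= 1 - 4^-1 -> expR (- 8) <= hat x.
Proof.
have aux (y : R) : 4^-1 <= y -> expR (- 4) <= flat 0 y.
  move=> y4; have y0 : 0 < y by apply: lt_le_trans y4.
  rewrite /flat y0 expr0 mul1r ler_expR lerN2.
  by rewrite -(invrK 4) lef_pV2// posrE.
move=> /andP[x1 x2]; rewrite (_ : - 8 = - 4 + - 4); last by lra.
rewrite expRD; apply: ler_pM; rewrite ?expR_ge0 ?aux//; lra.
Qed.

End hat.

(** * Bounding plane integrals by constants times the area of a square *)

Section square_integral.
Context {R : realType}.
Implicit Types (f : R * R -> R) (a b K : R).

(* No measurability is needed because the integral of a nonnegative function is
   a supremum over the simple functions below it. *)
Lemma le_integral_nonmeasurable d (T : measurableType d)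
    (mu : {measure set T -> \bar R}) (f g : T -> \bar R) :
  (forall x, (0 <= g x)%E) -> (forall x, (f x <= g x)%E) ->
  (\int[mu]_x f x <= \int[mu]_x g x)%E.
Proof.
move=> g0 fg; rewrite integralE.
(* Discarding the negative part of [f] can only raise its integral. *)
apply: (@le_trans _ _ (\int[mu]_x f^\+ x)%E).
  by rewrite geeDl// leeNl oppe0 integral_ge0.
rewrite !ge0_integralE//.
apply: le_ereal_sup => _ [h hf <-]; exists h => //= x.
apply: le_trans (hf x) _.
by rewrite !patch_setT funeposE ge_max fg g0.
Qed.

Definition square a b : set (R * R) := `[a, b] `*` `[a, b].

Lemma integral2_square a b K : a <= b -> 0 <= K ->
  integral2 (fun p => K * \1_(square a b) p) = (K * (b - a) ^+ 2)%:E.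
Proof.
move=> ab K0; rewrite /integral2.
have mQ : measurable (square a b) by exact: measurableX.
have mI : lebesgue_measure (`[a, b] : set R) = (b - a)%:E.
  rewrite lebesgue_measure_itv/= lte_fin; case: ltgtP ab => // -> _.
  by rewrite subrr.
under eq_integral do rewrite EFinM.
rewrite ge0_integralZl//; last first.
  exact/measurable_realfun.measurable_EFinP.
rewrite integral_indic// setIT /square.
rewrite [X in (_ * X)%E](_ : _ = ((b - a) ^+ 2)%:E) ?EFinM//.
transitivity (lebesgue_measure (`[a, b] : set R) * lebesgue_measure (`[a, b] : set R))%E.
  exact: product_measure1E.
by rewrite mI.
Qed.

(** Here [f] may change sign, as the helicity density does. *)
Lemma integral2_le f a b K : a <= b -> 0 <= K ->
  (forall p, f p <= K * \1_(square a b) p) ->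
  (integral2 f <= (K * (b - a) ^+ 2)%:E)%E.
Proof.
move=> ab K0 fK; rewrite -integral2_square//.
apply: le_integral_nonmeasurable => p; rewrite lee_fin//.
by rewrite mulr_ge0.
Qed.

Lemma integral2_ge f a b K : a <= b -> 0 <= K -> (forall p, 0 <= f p) ->
  (forall p, K * \1_(square a b) p <= f p) ->
  ((K * (b - a) ^+ 2)%:E <= integral2 f)%E.
Proof.
move=> ab K0 f0 fK; rewrite -integral2_square//.
by apply: le_integral_nonmeasurable => p; rewrite lee_fin.
Qed.

End square_integral.

(** * The normalizing factor and its derivatives *)

Section profile.
Context {R : realType}.
Implicit Types (s x t dg : R) (g : R -> R).

Definition isqrt s : R := (Num.sqrt (1 + s ^+ 2))^-1.

Lemma isqrt_gt0 s : 0 < isqrt s.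
Proof. by rewrite invr_gt0 sqrtr_gt0 ltr_wpDr// sqr_ge0. Qed.

(** A division-free relation: with it, the later estimates become polynomial in s and v =
    [isqrt s]. *)
Lemma isqrt_sqr s : isqrt s ^+ 2 * (1 + s ^+ 2) = 1.
Proof.
have h : 0 < 1 + s ^+ 2 by rewrite ltr_wpDr// sqr_ge0.
by rewrite exprVn sqr_sqrtr ?ltW// mulVf// gt_eqF.
Qed.

Lemma isqrt_le1 s : isqrt s <= 1.
Proof.
rewrite invf_le1 ?sqrtr_gt0; last by rewrite ltr_wpDr// sqr_ge0.
by rewrite -{1}sqrtr1 ler_wsqrtr// lerDl sqr_ge0.
Qed.

Lemma is_derive_isqrt s : is_derive s 1 isqrt (- s * isqrt s ^+ 3).
Proof.
have h : 0 < 1 + s ^+ 2 by rewrite ltr_wpDr// sqr_ge0.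
have d1 : is_derive s 1 (fun y : R => 1 + y ^+ 2) (2 * s).
  rewrite (_ : (fun y => _) = cst 1 + id ^+ 2); last by apply/funext => y; rewrite !fctE.
  have e := is_deriveD (is_derive_cst (1 : R) s 1) (is_deriveX 2 (is_derive_id s 1)).
  apply: (is_derive_eq e).
  by rewrite /GRing.scale/= add0r mulr1 expr1.
have d2 := @is_derive1_comp _ Num.sqrt _ s _ _ (is_derive1_sqrt h) d1.
have s0 : (Num.sqrt \o (fun y : R => 1 + y ^+ 2)) s != 0 by rewrite /= gt_eqF// sqrtr_gt0.
apply: is_derive_eq (is_deriveV s0 d2) _.
rewrite /isqrt /GRing.scale/=; move: s0 => /=; set q := Num.sqrt _ => q0.
by field.
Qed.

Lemma is_derive_isqrt_comp g x dg t : is_derive x 1 g dg ->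
  is_derive x 1 (fun y => isqrt (t * g y))
    (- (t * g x) * isqrt (t * g x) ^+ 3 * (t * dg)).
Proof.
move=> gx; have dtg : is_derive x 1 (fun y => t * g y) (t * dg) by exact: is_deriveZ.
exact: (@is_derive1_comp _ isqrt _ _ _ _ (is_derive_isqrt _) dtg).
Qed.

Lemma is_derive_mul_isqrt_comp g x dg t : is_derive x 1 g dg ->
  is_derive x 1 (fun y => t * g y * isqrt (t * g y))
    (isqrt (t * g x) ^+ 3 * (t * dg)).
Proof.
move=> gx.
have d1 : is_derive x 1 (fun y => t * g y) (t * dg) by exact: is_deriveZ.
apply: is_derive_eq (is_deriveM d1 (is_derive_isqrt_comp _ _ _ t gx)) _.
have := isqrt_sqr (t * g x); rewrite /GRing.scale/=.
set s := t * g x; set v := isqrt s; set d := t * dg => h.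
(* Inserting 1 = v^2 (1 + s^2) into the term v d produces v^3 d + s^2 v^3 d, whose last summand
   cancels the other product-rule term. *)
transitivity (s * (- s * v ^+ 3 * d) + v * (v ^+ 2 * (1 + s ^+ 2)) * d).
  by rewrite h mulr1.
by ring.
Qed.

End profile.

(** * Energy densities of the field tilted in one direction *)

Section tilt.
Context {R : realType}.
Variables (f f1 f2 : R * R -> R) (t : R).
Hypothesis df1 : forall p : R * R, is_derive p.1 1 (fun s => f (s, p.2)) (f1 p).
Hypothesis df2 : forall p : R * R, is_derive p.2 1 (fun s => f (p.1, s)) (f2 p).

Definition tilt : field3 R :=
  Field3 (fun p => t * f p * isqrt (t * f p)) (fun=> 0)
         (fun p => isqrt (t * f p)).

Lemma normalize_pertE :
  normalize_pert (Field3 f (fun=> 0) (fun=> 0)) t = tilt.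
Proof.
have e p : Num.sqrt ((t * f p) ^+ 2 + (t * 0) ^+ 2 + (1 + t * 0) ^+ 2)
    = Num.sqrt (1 + (t * f p) ^+ 2).
  by congr Num.sqrt; ring.
rewrite /normalize_pert /tilt /isqrt /=; congr Field3; apply/funext => p.
- by rewrite e.
- by rewrite mulr0 mul0r.
- by rewrite e mulr0 addr0 mul1r.
Qed.

Lemma partial1_tilt1 p :
  partial1 (c1 tilt) p = isqrt (t * f p) ^+ 3 * (t * f1 p).
Proof.
case: p => x y; exact: derive1_is_derive (is_derive_mul_isqrt_comp _ _ _ t (df1 (x, y))).
Qed.

Lemma partial2_tilt1 p :
  partial2 (c1 tilt) p = isqrt (t * f p) ^+ 3 * (t * f2 p).
Proof.
case: p => x y; exact: derive1_is_derive (is_derive_mul_isqrt_comp _ _ _ t (df2 (x, y))).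
Qed.

Lemma partial1_tilt3 p :
  partial1 (c3 tilt) p = - (t * f p) * isqrt (t * f p) ^+ 3 * (t * f1 p).
Proof.
case: p => x y; exact: derive1_is_derive (is_derive_isqrt_comp _ _ _ t (df1 (x, y))).
Qed.

Lemma partial2_tilt3 p :
  partial2 (c3 tilt) p = - (t * f p) * isqrt (t * f p) ^+ 3 * (t * f2 p).
Proof.
case: p => x y; exact: derive1_is_derive (is_derive_isqrt_comp _ _ _ t (df2 (x, y))).
Qed.

Lemma partial1_cst (c : R) p : partial1 (fun=> c) p = 0.
Proof. exact: derive1_cst. Qed.

Lemma partial2_cst (c : R) p : partial2 (fun=> c) p = 0.
Proof. exact: derive1_cst. Qed.

Lemma dirichlet_tiltE p : dirichlet_density tilt p =
  t ^+ 2 * (f1 p ^+ 2 + f2 p ^+ 2) * isqrt (t * f p) ^+ 4 / 2.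
Proof.
rewrite /dirichlet_density partial1_tilt1 partial2_tilt1 partial1_tilt3.
rewrite partial2_tilt3 /= partial1_cst partial2_cst.
have := isqrt_sqr (t * f p); set s := t * f p; set v := isqrt s => h.
(* The squared derivatives of the two components add up to v^6 (1 + s^2), which is v^4; multiplying
   the right side by 1 = v^2 (1 + s^2) makes this a polynomial identity. *)
rewrite -[RHS]mulr1 -h; ring.
Qed.

Lemma helicity_tiltE p : helicity_density tilt p =
  t * f2 p * isqrt (t * f p) ^+ 3
  * (1 - isqrt (t * f p) - (t * f p) ^+ 2 * isqrt (t * f p)).
Proof.
rewrite /helicity_density partial2_tilt1 partial1_tilt3 partial2_tilt3 /=.
by rewrite partial1_cst; ring.
Qed.

(** From (1 - v)(1 + v) = s^2 v^2 with 0 < v <= 1. *)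
Lemma isqrt_defect (s : R) : 0 <= 1 - isqrt s <= s ^+ 2.
Proof.
have := isqrt_sqr s; have := isqrt_gt0 s; have := isqrt_le1 s; have := sqr_ge0 s.
set v := isqrt s; set q := s ^+ 2 => q0 v1 v0 h; nra.
Qed.

(** For s^2 <= 1 one has v^2 >= 1/2 and 1 + v <= 2, so s^2 v^2 / (1 + v) is at least s^2 / 4; the
    constant 1/6 leaves slack. *)
Lemma isqrt_defect_ge (s : R) : s ^+ 2 <= 1 -> s ^+ 2 / 6 <= 1 - isqrt s.
Proof.
have := isqrt_sqr s; have := isqrt_gt0 s; have := isqrt_le1 s; have := sqr_ge0 s.
set v := isqrt s; set q := s ^+ 2 => q0 v1 v0 h q1.
have v2 : 2^-1 <= v ^+ 2 by nra.
have e : (1 - v) * (1 + v) = q * v ^+ 2 by nra.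
nra.
Qed.

Lemma dirichlet_tilt_le p : dirichlet_density tilt p <=
  t ^+ 2 * (f1 p ^+ 2 + f2 p ^+ 2) / 2.
Proof.
rewrite dirichlet_tiltE ler_wpM2r// ler_piMr//.
  by rewrite mulr_ge0 ?addr_ge0 ?sqr_ge0.
by rewrite exprn_ile1 ?isqrt_le1// ltW ?isqrt_gt0.
Qed.

(** The bracket 1 - v - s^2 v is a difference of two numbers in [0, s^2]; together with the factor t
    from the derivative this gives cubic order in t. *)
Lemma helicity_tilt_le p : helicity_density tilt p <=
  `|t * f2 p| * (t * f p) ^+ 2.
Proof.
rewrite helicity_tiltE; set s := t * f p.
have /andP[] := isqrt_defect s; have := isqrt_gt0 s; have := isqrt_le1 s; have := sqr_ge0 s.
set v := isqrt s; set q := s ^+ 2 => q0 v1 v0 h1 h2.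
apply: le_trans (ler_norm _) _; rewrite -mulrA normrM ler_wpM2l// normrM.
rewrite -[leRHS]mul1r ler_pM//.
  by rewrite ger0_norm ?exprn_ge0 ?exprn_ile1// (ltW v0).
rewrite ler_norml; apply/andP; split; nra.
Qed.

Lemma potential_tilt_le p : potential_density tilt p <= (t * f p) ^+ 4 / 2.
Proof.
rewrite /potential_density /=; set s := t * f p.
have := isqrt_sqr s; have := isqrt_gt0 s; have := isqrt_le1 s; have := sqr_ge0 s.
have /andP[] := isqrt_defect s.
rewrite (_ : s ^+ 4 = (s ^+ 2) ^+ 2); last by rewrite -exprM.
rewrite [(s * isqrt s) ^+ 2]exprMn expr0n addr0.
set v := isqrt s; set q := s ^+ 2 => h1 h2 q0 v1 v0 h.
(* Unit length turns |n - e3|^2 into 2 (1 - n3), so the density is (1 - v)^2 / 2. *)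
have e : q * v ^+ 2 + (v - 1) ^+ 2 = 2 * (1 - v) by nra.
rewrite e; nra.
Qed.

End tilt.

(** * The dilated bump on a square of side L and its energy estimates *)

Section cutoff.
Context {R : realType}.
Variable L : R.
Hypothesis L0 : 0 < L.

Definition cutoff (p : R * R) : R := hat (p.1 / L) * hat (p.2 / L).
Definition cutoff1 (p : R * R) : R := dhat (p.1 / L) / L * hat (p.2 / L).
Definition cutoff2 (p : R * R) : R := hat (p.1 / L) * (dhat (p.2 / L) / L).

Let is_derive_scaled_hat (x : R) :
  is_derive x 1 (fun y => hat (y / L)) (dhat (x / L) / L).
Proof.
apply: (@is_derive1_comp _ hat (fun y : R => y / L)); first exact: is_derive_hat.
rewrite (_ : (fun y : R => y / L) = (fun y => L^-1 * y + 0)).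
  exact: is_derive_affine.
by apply/funext => y; rewrite addr0 mulrC.
Qed.

Lemma is_derive_cutoff1 (p : R * R) :
  is_derive p.1 1 (fun s => cutoff (s, p.2)) (cutoff1 p).
Proof.
exact: (is_derive_mulr _ (fun x => dhat (x / L) / L) p.1 (hat (p.2 / L))
   (is_derive_scaled_hat p.1)). Qed.

Lemma is_derive_cutoff2 (p : R * R) :
  is_derive p.2 1 (fun s => cutoff (p.1, s)) (cutoff2 p).
Proof.
exact: (is_derive_mull _ (fun x => dhat (x / L) / L) p.2 (hat (p.1 / L))
   (is_derive_scaled_hat p.2)). Qed.

Lemma smooth_cutoff : smooth cutoff.
Proof.
move=> k; have h : Ck1 k (fun x : R => hat (x / L)).
  rewrite (_ : (fun x => _) = (fun x => hat (L^-1 * x + 0))).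
    exact/Ck1_affine/Ck1_hat.
  by apply/funext => x; rewrite addr0 mulrC.
exact: (Ck_tensor k _ _ h h).
Qed.

Lemma cutoff_ge0 p : 0 <= cutoff p.
Proof. by rewrite mulr_ge0 ?hat_ge0. Qed.

Lemma cutoff_le1 p : cutoff p <= 1.
Proof. by rewrite mulr_ile1 ?hat_ge0 ?hat_le1. Qed.

Let norm_scaled_dhat_le (x : R) : `|dhat (x / L) / L| <= 2 / L.
Proof.
by rewrite normrM [`|L^-1|]gtr0_norm ?invr_gt0// ler_wpM2r ?norm_dhat_le ?invr_ge0 ?ltW.
Qed.

Lemma norm_cutoff1_le p : `|cutoff1 p| <= 2 / L.
Proof.
rewrite normrM -[leRHS]mulr1 ler_pM//.
by rewrite ger0_norm ?hat_ge0 ?hat_le1.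
Qed.

Lemma norm_cutoff2_le p : `|cutoff2 p| <= 2 / L.
Proof.
rewrite normrM -[leRHS]mul1r ler_pM//.
by rewrite ger0_norm ?hat_ge0 ?hat_le1.
Qed.

(** The derivatives are included so that every energy density can be dominated by a multiple of the
    indicator of the square. *)
Lemma cutoff_out p : ~ square 0 L p ->
  [/\ cutoff p = 0, cutoff1 p = 0 & cutoff2 p = 0].
Proof.
move=> pQ; rewrite /cutoff /cutoff1 /cutoff2.
have [h1|/hat_dhat_out[-> ->]] := boolP (0 <= p.1 / L <= 1); last first.
  by rewrite !mul0r.
have [h2|/hat_dhat_out[-> ->]] := boolP (0 <= p.2 / L <= 1); last first.
  by rewrite !mul0r !mulr0.
exfalso; apply: pQ; split; rewrite /= in_itv/=.
  by move: h1; rewrite ler_pdivlMr// mul0r ler_pdivrMr// mul1r.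
by move: h2; rewrite ler_pdivlMr// mul0r ler_pdivrMr// mul1r.
Qed.

Lemma cutoff_ge p : square (L / 4) (L * (1 - 4^-1)) p ->
  expR (- 8) ^+ 2 <= cutoff p.
Proof.
have aux x : `[L / 4, L * (1 - 4^-1)]%classic x -> expR (- 8) <= hat (x / L).
  rewrite /= in_itv/= => /andP[x1 x2]; apply: hat_ge.
  by rewrite ler_pdivlMr// ler_pdivrMr// mulrC x1 mulrC.
by move=> [/aux h1 /aux h2]; rewrite expr2 ler_pM ?expR_ge0.
Qed.

Lemma compact_support_cutoff : compact_support cutoff.
Proof.
have cQ : compact (square 0 L) by apply: compact_setX; exact: segment_compact.
apply: (subclosed_compact _ cQ); first exact: closed_closure.
have clQ : closed (square 0 L).
  by apply: compact_closed cQ; exact: norm_hausdorff.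
have /closure_id-> := clQ; apply: closureS => p /=.
by apply: contraNP => /cutoff_out[-> _ _].
Qed.

Lemma le_indic_square (F : R * R -> R) K p :
  F p <= K -> (~ square 0 L p -> F p <= 0) -> F p <= K * \1_(square 0 L) p.
Proof.
move=> FK F0; rewrite indicE; have [pQ|pQ] := boolP (p \in square 0 L).
  by rewrite mulr1.
by move: pQ; rewrite notin_setE mulr0 => /F0.
Qed.

Variable t : R.
Local Notation n := (tilt cutoff t).

Lemma Denergy_cutoff_le : (Denergy n <= (4 * t ^+ 2)%:E)%E.
Proof.
(* The gradient bound 2 / L, squared, exactly compensates the area L^2: this is the scale
   invariance. *)
rewrite (_ : 4 * t ^+ 2 = (t ^+ 2 * (2 / L) ^+ 2) * (L - 0) ^+ 2); last first.
  by rewrite subr0; field; rewrite gt_eqF.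
apply: integral2_le => [||p]; first exact: ltW.
  by rewrite mulr_ge0 ?sqr_ge0.
apply: le_indic_square => [|/cutoff_out[_ e1 e2]];
  apply: le_trans (dirichlet_tilt_le _ _ _ t is_derive_cutoff1 is_derive_cutoff2 p) _.
  rewrite -mulrA ler_wpM2l ?sqr_ge0// ler_pdivrMr// mulr_natr mulr2n.
  have sq (x : R) : `|x| <= 2 / L -> x ^+ 2 <= (2 / L) ^+ 2.
    move=> xL; rewrite -real_normK ?num_real// lerXn2r// nnegrE.
    exact: le_trans xL.
  by rewrite lerD// sq ?norm_cutoff1_le ?norm_cutoff2_le.
by rewrite e1 e2 !expr0n addr0 mulr0 mul0r.
Qed.

Lemma Henergy_cutoff_le : (Henergy n <= (2 * L * `|t| ^+ 3)%:E)%E.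
Proof.
(* A single derivative contributes 2 / L against the area L^2, so one factor L remains. *)
rewrite (_ : 2 * L * _ = (`|t| ^+ 3 * (2 / L)) * (L - 0) ^+ 2); last first.
  by rewrite subr0; field; rewrite gt_eqF.
have L2 : 0 <= 2 / L by rewrite divr_ge0// ltW.
apply: integral2_le => [||p]; first exact: ltW.
  by rewrite mulr_ge0// exprn_ge0.
apply: le_indic_square => [|/cutoff_out[e0 _ _]];
  apply: le_trans (helicity_tilt_le _ _ _ t is_derive_cutoff1 is_derive_cutoff2 p) _.
  rewrite normrM exprMn -[t ^+ 2](real_normK (num_real t)).
  rewrite [leRHS](_ : _ = `|t| * (2 / L) * (`|t| ^+ 2 * 1)); last by ring.
  apply: ler_pM.
  - by rewrite mulr_ge0.
  - by rewrite -exprMn sqr_ge0.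
  - by rewrite ler_wpM2l// norm_cutoff2_le.
  - by rewrite ler_wpM2l ?sqr_ge0// exprn_ile1 ?cutoff_ge0 ?cutoff_le1.
by rewrite e0 mulr0 expr0n mulr0.
Qed.

Lemma Venergy_cutoff_le : (Venergy n <= (t ^+ 4 / 2 * L ^+ 2)%:E)%E.
Proof.
rewrite -[L in leRHS]subr0.
have t4 : 0 <= t ^+ 4 by rewrite exprn_even_ge0.
apply: integral2_le => [||p]; first exact: ltW.
  by rewrite divr_ge0.
apply: le_indic_square => [|/cutoff_out[e0 _ _]];
  apply: le_trans (potential_tilt_le _ t p) _.
  rewrite ler_wpM2r// exprMn ler_piMr//.
  by rewrite exprn_ile1 ?cutoff_ge0 ?cutoff_le1.
by rewrite e0 mulr0 expr0n mul0r.
Qed.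

(** Only the concentric square of side L / 2 is kept, where the bump is at least e^(-16). The
    constant 24 is the 6 of [isqrt_defect_ge] times the 4 from the area L^2 / 4. *)
Lemma Zenergy_cutoff_ge : `|t| <= 1 ->
  ((t ^+ 2 * expR (- 8) ^+ 4 / 24 * L ^+ 2)%:E <= Zenergy n)%E.
Proof.
move=> t1; set c := expR _; have c0 : 0 <= c by exact: expR_ge0.
rewrite (_ : _ * L ^+ 2
    = t ^+ 2 * c ^+ 4 / 6 * (L * (1 - 4^-1) - L / 4) ^+ 2); last by field.
apply: integral2_ge => [|||p].
- rewrite ler_pM2l//; lra.
- by rewrite divr_ge0// mulr_ge0 ?sqr_ge0// exprn_ge0.
- by move=> p; rewrite /zeeman_density /=; have /andP[] := isqrt_defect (t * cutoff p).
rewrite /zeeman_density /= indicE.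
have [|_] := boolP (p \in _); last first.
  by rewrite mulr0; have /andP[] := isqrt_defect (t * cutoff p).
rewrite in_setE mulr1 => /cutoff_ge cp.
apply: le_trans (isqrt_defect_ge _ _); last first.
  rewrite -real_normK ?num_real// exprn_ile1// normrM mulr_ile1//.
  by rewrite ger0_norm ?cutoff_ge0 ?cutoff_le1.
rewrite ler_wpM2r// exprMn ler_wpM2l ?sqr_ge0//.
rewrite (exprM c 2 2) lerXn2r// nnegrE ?exprn_ge0//; exact: cutoff_ge0.
Qed.

Lemma Energy_cutoff_le (r h : R) : 0 <= r -> h <= 0 -> `|t| <= 1 ->
  (Energy r h n <= (t ^+ 2 * (4 + 2 * (r * L * `|t|) + (L * `|t|) ^+ 2 / 2
     + h * expR (- 8) ^+ 4 / 24 * L ^+ 2))%:E)%E.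
Proof.
move=> r0 h0 t1.
have -> : t ^+ 2 * (4 + 2 * (r * L * `|t|) + (L * `|t|) ^+ 2 / 2
     + h * expR (- 8) ^+ 4 / 24 * L ^+ 2) =
    4 * t ^+ 2 + r * (2 * L * `|t| ^+ 3) + t ^+ 4 / 2 * L ^+ 2
    + h * (t ^+ 2 * expR (- 8) ^+ 4 / 24 * L ^+ 2).
  rewrite -[t ^+ 4]/(t ^+ (2 * 2)) exprM -(real_normK (num_real t)); by field.
rewrite !EFinD /Energy; apply: leeD.
  apply: leeD; last exact: Venergy_cutoff_le.
  apply: leeD; first exact: Denergy_cutoff_le.
  by rewrite EFinM lee_wpmul2l ?lee_fin// Henergy_cutoff_le.
(* As h <= 0, the lower bound on the Zeeman energy becomes an upper bound after multiplication by
   h. *)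
rewrite -[h]opprK mulNr !EFinN mulNe leeN2 EFinM.
by rewrite lee_wpmul2l ?lee_fin ?oppr_ge0// Zenergy_cutoff_ge.
Qed.

End cutoff.

(** * The constant field and the choice of parameters *)

Lemma Energy_e3map {R : realType} (r h : R) : Energy r h (e3map R) = 0%E.
Proof.
have i0 (F : R * R -> R) : (forall p, F p = 0) -> integral2 F = 0%E.
  by move=> F0; rewrite /integral2; apply: integral0_eq => p _; rewrite F0.
rewrite /Energy /Denergy /Henergy /Venergy /Zenergy !i0 ?mule0 ?adde0//.
- by move=> p; rewrite /zeeman_density subrr.
- by move=> p; rewrite /potential_density /= subrr !expr0n !addr0 expr0n mul0r.
- by move=> p; rewrite /helicity_density /= subrr !mul0r !addr0.
- by move=> p; rewrite /dirichlet_density /= !partial1_cst !partial2_cst !expr0n !addr0 mul0r.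
Qed.

Lemma Cc_infty0 {R : realType} : Cc_infty (fun=> 0 : R).
Proof.
split.
  move=> k; have := Ck_tensor k _ _ (Ck1_cst k 0) (Ck1_cst k (0 : R)).
  by rewrite (_ : (fun p => _) = (fun=> 0))//; apply/funext => p; rewrite mulr0.
rewrite /compact_support (_ : [set p | _] = set0).
  by rewrite closure0; exact: compact0.
by apply/seteqP; split => // p /=; rewrite eqxx.
Qed.

Theorem theorem5p3 (R : realType) (r h : R) (hr : 0 < r) (hh : h < 0) :
  Energy r h (e3map R) = 0%E /\
  exists phi : field3 R,
    [/\ Cc_infty (c1 phi), Cc_infty (c2 phi), Cc_infty (c3 phi) &
     exists2 delta : R, 0 < delta &
       forall t : R, 0 < `|t| < delta ->
         (Energy r h (normalize_pert phi t) < Energy r h (e3map R))%E].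
Proof.
split; first exact: Energy_e3map.
set c : R := expR (- 8) ^+ 4.
have c0 : 0 < c by rewrite exprn_gt0 ?expR_gt0.
have hc : 0 < - h * c by rewrite mulr_gt0 ?oppr_gt0.
(* Chosen so that the Zeeman term h c L^2 / 24 equals -6, which beats the Dirichlet constant 4 with
   room to spare. *)
pose L := Num.sqrt (144 / (- h * c)).
have L0 : 0 < L by rewrite sqrtr_gt0 divr_gt0.
have hL : h * c / 24 * L ^+ 2 = - 6.
  rewrite sqr_sqrtr; last by rewrite divr_ge0// ltW.
  by field; rewrite (lt_eqF hh) (gt_eqF c0).
exists (Field3 (cutoff L) (fun=> 0) (fun=> 0)); split; [|exact: Cc_infty0..|].
  by split; [exact: smooth_cutoff|exact: compact_support_cutoff].
(* The three bounds allow the Zeeman estimate, make 2 r L |t| < 1/2, and make (L |t|)^2 / 2 at most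
   1/2; the bracket is then below 4 + 1/2 + 1/2 - 6 = -1. *)
exists (Num.min 1 (Num.min (4 * (r * L))^-1 L^-1)).
  by rewrite !lt_min ltr01 !invr_gt0 !mulr_gt0.
move=> t /andP[t0]; rewrite !lt_min => /and3P[t1 t2 t3].
rewrite Energy_e3map normalize_pertE.
apply: le_lt_trans (Energy_cutoff_le L L0 t r h (ltW hr) (ltW hh) (ltW t1)) _.
rewrite lte_fin -/c hL pmulr_rlt0 ?exprn_even_gt0 -?normr_gt0//.
have h2 : 4 * (r * L) * `|t| < 1 by rewrite mulrC -ltr_pdivlMr ?mulr_gt0// mul1r.
have h3 : L * `|t| < 1 by rewrite mulrC -ltr_pdivlMr// mul1r.
have h4 : (L * `|t|) ^+ 2 <= 1 by rewrite exprn_ile1 ?ltW// mulr_gt0.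
lra.
Qed.
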